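(* Let $\mathcal B\subseteq\mathbb N$ be infinite and assume that $\mathcal B$ is primitive. Then the window $W$ is topologically aperiodic, i.e. $\{h\in H:W+h=W\}=\{0\}$.
   Context: $\mathbb N=\{1,2,\dots\}$. $\mathcal B$ is primitive if there are no distinct $b,b'\in\mathcal B$ with $b\mid b'$. $\Delta:\mathbb Z\to\prod_{b\in\mathcal B}\mathbb Z/b\mathbb Z$, $\Delta(n)=(n \bmod b)_{b\in\mathcal B}$; $H:=\overline{\Delta(\mathbb Z)}$ is a compact abelian group (product topology); the window is $W:=\{h\in H: h_b\neq 0\ \forall b\in\mathcal B\}$. *)

(* Defs.v *)
From HB Require Import structures.
From mathcomp Require Import all_boot all_order all_algebra.
From mathcomp Require Import all_classical topology.

Set Implicit Arguments.
Unset Strict Implicit.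
Unset Printing Implicit Defensive.

Import GRing.Theory.
Local Open Scope classical_set_scope.
Local Open Scope ring_scope.

(* The group Z/bZ for b >= 1. The carrier is not 'Z_b because 'Z_1 has two
   elements; the .-1.+1 is only there to get the canonical additive group
   structure of 'I_n.+1. For b = 0 this is the trivial group (unused). *)
Definition Zmod (b : nat) : Type := 'I_b.-1.+1.

HB.instance Definition _ (b : nat) := GRing.Zmodule.on (Zmod b).
HB.instance Definition _ (b : nat) :=
  Topological.copy (Zmod b) (discrete_topology 'I_b.-1.+1).

Definition zmod_of_int (b : nat) (n : int) : Zmod b := inZp `|(n %% b)%Z|.

Definition primitive_set (B : set nat) : Prop :=
  ~ exists b b' : nat, [/\ B b, B b', b <> b' & (b %| b')%N].

Section Window.
Variable B : set nat.

Definition prodZmod : Type := prod_topology (fun b : B => Zmod (set_val b)).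

HB.instance Definition _ := Topological.on prodZmod.

Definition prodZmod_zero : prodZmod := fun=> 0.
Definition prodZmod_opp (g : prodZmod) : prodZmod := fun b => - g b.
Definition prodZmod_add (g h : prodZmod) : prodZmod := fun b => g b + h b.

Fact prodZmod_addA : associative prodZmod_add.
Proof. by move=> f g h; apply: functional_extensionality_dep => b; exact: addrA. Qed.

Fact prodZmod_addC : commutative prodZmod_add.
Proof. by move=> g h; apply: functional_extensionality_dep => b; exact: addrC. Qed.

Fact prodZmod_add0 : left_id prodZmod_zero prodZmod_add.
Proof. by move=> g; apply: functional_extensionality_dep => b; exact: add0r. Qed.

Fact prodZmod_addN : left_inverse prodZmod_zero prodZmod_opp prodZmod_add.
Proof. by move=> g; apply: functional_extensionality_dep => b; exact: addNr. Qed.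

HB.instance Definition _ := GRing.isZmodule.Build prodZmod
  prodZmod_addA prodZmod_addC prodZmod_add0 prodZmod_addN.

Definition Delta (n : int) : prodZmod := fun b => zmod_of_int (set_val b) n.

Definition groupH : set prodZmod := closure (range Delta).

Definition window : set prodZmod :=
  [set h | groupH h /\ forall b : B, h b <> 0].

End Window.

Arguments Delta : clear implicits.
Arguments groupH : clear implicits.
Arguments window : clear implicits.

(* Main.v *)
(** If [h b <> 0] for some [b] in [B], then some [x] in the window has
    [x b = h b]; it is not in [W + h], because the [b]-coordinate of [x - h]
    vanishes. To build [x], let [r] be the residue [h b] and [g = gcd(r, b)],
    a proper divisor of [b]. For every [n] there is an integer [m_n = r] mod [b]
    whose only common divisors with [n!] are divisors of [g]. Let [x] be a
    cluster point of the points [Delta m_n] in the compact product. If a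
    coordinate [x b'] were zero, then [b'] would divide some [m_n] with
    [b' <= n], hence divide [g], hence be a proper divisor of [b], against
    primitivity. *)
Require Import Defs.
From mathcomp Require Import all_boot all_order all_algebra.
From mathcomp Require Import all_classical topology.
From mathcomp Require Import zify.
Local Open Scope classical_set_scope.
Local Open Scope ring_scope.

Import GRing.Theory.

(** Let [p] be a prime divisor of [n]. If [p] divides [a], it divides neither [c] nor the
    [\pi(a)^']-part of [n]; otherwise it divides that part but not [a]. Either way [p] divides
    exactly one of the two summands. *)
Lemma coprime_add_mul_partC (a c n : nat) :
  (0 < a)%N -> (0 < n)%N -> coprime a c ->
  coprime (a + c * (n`_(\pi(a)^'))%N) n.
Proof.
move=> a_gt0 n_gt0 co_ac; set t := (n`_(\pi(a)^'))%N.
have co_at : coprime a t by rewrite coprime_pi' ?part_gt0 ?part_pnat.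
rewrite -(partnC (\pi(a))%N n_gt0) coprimeMr; apply/andP; split.
  rewrite coprime_sym; apply: (@pnat_coprime (\pi(a))%N); first exact: part_pnat.
  rewrite -coprime_pi' ?addn_gt0 ?a_gt0 //.
  by rewrite /coprime gcdnDl -/(coprime _ _) coprimeMr co_ac.
by rewrite -/t coprime_sym /coprime addnC gcdnMDl -/(coprime _ _) coprime_sym.
Qed.

(** With [r = g * a] and [b = g * c], the witness is [r + t * b = g * (a + c * t)], where [t] makes
    the second factor coprime to [n]. *)
Lemma exists_eqmod_gcdn_dvd (r b n : nat) : (0 < r)%N -> (0 < n)%N ->
  exists m, m = r %[mod b] /\ (gcdn m n %| gcdn r b)%N.
Proof.
move=> r_gt0 n_gt0; set g := gcdn r b.
have g_gt0 : (0 < g)%N by rewrite gcdn_gt0 r_gt0.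
have [/divnK rE /divnK bE] : (g %| r)%N /\ (g %| b)%N.
  by rewrite dvdn_gcdl dvdn_gcdr.
set a := (r %/ g)%N in rE; set c := (b %/ g)%N in bE.
have a_gt0 : (0 < a)%N by rewrite divn_gt0 // dvdn_leq // dvdn_gcdl.
have co_ac : coprime a c.
  by rewrite /coprime -(eqn_pmul2r g_gt0) muln_gcdl rE bE mul1n.
set t := (n`_(\pi(a)^'))%N; exists (r + t * b)%N; split; first by rewrite addnC modnMDl.
have -> : (r + t * b = g * (a + c * t))%N by rewrite -{1}rE -{1}bE; lia.
by rewrite gcdnC Gauss_gcdl ?dvdn_gcdr // coprime_sym coprime_add_mul_partC.
Qed.

Lemma zmod_of_nat_eqP (b m n : nat) : (0 < b)%N ->
  zmod_of_int b m%:Z = zmod_of_int b n%:Z <-> m = n %[mod b].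
Proof.
move=> b_gt0; rewrite /zmod_of_int !modz_nat !absz_nat; split.
  by move/(congr1 val) => /=; rewrite prednK // !modn_mod.
by move=> ->.
Qed.

Lemma zmod_of_nat_ord (b : nat) (z : Zmod b) : (0 < b)%N ->
  zmod_of_int b (val z)%:Z = z.
Proof.
move=> b_gt0; apply/val_inj; rewrite /zmod_of_int modz_nat absz_nat /=.
by rewrite !modn_small ?prednK // -[X in (_ < X)%N](prednK b_gt0) ltn_ord.
Qed.

Lemma Delta0 (B : set nat) : Delta B 0 = 0.
Proof.
apply: functional_extensionality_dep => b; apply/val_inj.
by rewrite /Delta /zmod_of_int mod0z /= mod0n.
Qed.

Lemma prodZmod_compact (B : set nat) : compact [set: prodZmod B].
Proof.
have Zmod_compact (b : B) : compact [set: Zmod (set_val b)].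
  by apply: finite_compact; exact: (@finite_finset 'I_(set_val b).-1.+1).
by have := tychonoff Zmod_compact; congr compact; apply/seteqP; split.
Qed.

Lemma nbhs_coord (B : set nat) (x : prodZmod B) (b : B) :
  nbhs x [set y : prodZmod B | y b = x b].
Proof.
have := @proj_continuous B (fun b : B => Zmod (set_val b)) b x [set x b].
apply; exact: (@discrete_set1 (discrete_topology 'I_(set_val b).-1.+1)).
Qed.

Lemma exists_window_coord (B : set nat)
    (B_pos : forall b : nat, B b -> (0 < b)%N)
    (B_primitive : primitive_set B) (b : B) (z : Zmod (set_val b)) :
  z <> 0 -> exists2 x, window B x & x b = z.
Proof.
move=> z_neq0; set r := val z.
have Bgt0 (c : B) : (0 < set_val c)%N by apply: B_pos; exact: set_valP.
have r_gt0 : (0 < r)%N by rewrite lt0n; apply/eqP => r0; apply/z_neq0/val_inj.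
have r_lt : (r < set_val b)%N by rewrite -[ltnRHS](prednK (Bgt0 b)) ltn_ord.
pose P n m := m = r %[mod set_val b] /\ (gcdn m n`! %| gcdn r (set_val b))%N.
have /choice[m mP] n : exists m, P n m by exact: exists_eqmod_gcdn_dvd (fact_gt0 n).
pose u n := Delta B (m n)%:Z.
have [x [_ x_cluster]] := @prodZmod_compact B (u @ \oo) _ filterT.
(* Arbitrarily large indices matter: below, [n] has to reach [set_val c] so that [set_val c] divides
   the factorial of [n]. *)
have meets (V : set (prodZmod B)) (N : nat) : nbhs x V ->
    exists2 n, (N <= n)%N & V (u n).
  move=> xV; have [] := x_cluster (u @` [set n | (N <= n)%N]) V _ xV.
    by exists N => // n Nn; exists n.
  by move=> _ [[n Nn <-] Vn]; exists n.
(* The factors are discrete, so closeness to [x] gives equality at a coordinate. *)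
have x_coord (c : B) N : exists2 n, (N <= n)%N & u n c = x c.
  exact: (meets _ N (nbhs_coord B x c)).
exists x; last first.
  have [n _ unb] := x_coord b 0%N; rewrite -unb.
  rewrite -[RHS](zmod_of_nat_ord _ z (Bgt0 b)).
  by apply/zmod_of_nat_eqP => //; exact: (mP n).1.
split=> [V xV|c xc0].
  by have [n _ Vn] := meets V 0%N xV; exists (u n); split=> //; exists (m n)%:Z.
(* Reading [0] as a coordinate of [Delta B 0] turns the vanishing into a congruence [m n = 0] modulo
   [set_val c]. *)
have [n c_le_n] := x_coord c (set_val c); rewrite xc0 -[0]/((0 : prodZmod B) c) -Delta0.
move=> /(zmod_of_nat_eqP _ _ 0 (Bgt0 c)) /eqP; rewrite mod0n -/(dvdn _ _) => c_dvd_m.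
have c_dvd_g : (set_val c %| gcdn r (set_val b))%N.
  apply: dvdn_trans (mP n).2; rewrite dvdn_gcd c_dvd_m dvdn_fact //.
  by rewrite Bgt0.
move: c_dvd_g; rewrite dvdn_gcd => /andP[/(dvdn_leq r_gt0) c_le_r c_dvd_b].
apply: B_primitive; exists (set_val c), (set_val b); split=> //; try exact: set_valP.
(* The two elements differ because [set_val c <= r < set_val b]. *)
by move=> cb; move: r_lt; rewrite -cb ltnNge c_le_r.
Qed.

Theorem proposition5p1 (B : set nat)
    (B_pos : forall b : nat, B b -> (0 < b)%N)
    (B_infinite : infinite_set B)
    (B_primitive : primitive_set B) :
  [set h : prodZmod B | groupH B h /\ [set w + h | w in window B] = window B]
  = [set 0].
Proof.
apply/seteqP; split=> [h [_ Wh]|_ ->] /=.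
  apply: functional_extensionality_dep => b; apply: contrapT => hb_neq0.
  have [x] := exists_window_coord B B_pos B_primitive b (h b) hb_neq0.
  rewrite -{1}Wh => -[w [_ w_neq0] <-] whb; apply: (w_neq0 b).
  by apply: (addIr (h b)); rewrite add0r.
split; first by apply: subset_closure; exists 0 => //; exact: Delta0.
apply/seteqP; split=> [_ [w Ww <-]|w Ww]; first by rewrite addr0.
by exists w => //; rewrite addr0.
Qed.
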